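(* Let $v:\mathbb{R}/\mathbb{Z}\to\mathbb{R}$ be a function which is $C^1$ on $(0,1)$ (identifying $\mathbb{R}/\mathbb{Z}$ with $[0,1)$), such that $\sup_{x\in(0,1)}(|v(x)|+|v'(x)|)<\infty$, $\inf_{x\in(0,1)}|v'(x)|>0$, and $v(0)=\lim_{x\to0+}v(x)$. Then there exists a constant $C_0=C_0(v)>0$, depending only on $v$, such that for all $\lambda>0$ and all $E\in\mathbb{R}$, $$L(E;\lambda)>\log\lambda-C_0,$$ where $L(E;\lambda)$ is the Lyapunov exponent, over the doubling map, of the family of Schr\''odinger operators with potential $\lambda v(2^n x)$ at energy $E$.
   Context: Let $T:\mathbb{R}/\mathbb{Z}\to\mathbb{R}/\mathbb{Z}$, $T(x)=2x$, be the doubling map. The Schr\''odinger operators are $(H_xu)_n=u_{n+1}+u_{n-1}+\lambda v(2^nx)u_n$ on $\ell^2(\mathbb{N})$ (with $0\in\mathbb{N}$) with Dirichlet condition $u_{-1}=0$, where $x\in\mathbb{R}/\mathbb{Z}$. For $E\in\mathbb{R}$ and $\lambda>0$ the associated Schr\''odinger cocycle map is $$A^{(E-\lambda v)}(x)=\begin{pmatrix}E-\lambda v(x)&-1\\1&0\end{pmatrix}\in\mathrm{SL}(2,\mathbb{R}),$$ with iterates $A^{(E-\lambda v)}_n(x)=A^{(E-\lambda v)}(T^{n-1}x)\cdots A^{(E-\lambda v)}(x)$ for $n\ge1$ and $A_0^{(E-\lambda v)}=I_2$. The Lyapunov exponent is $$L(E;\lambda)=\lim_{n\to\infty}\frac1n\int_{\mathbb{R}/\mathbb{Z}}\log\|A_n^{(E-\lambda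 v)}(x)\|\,dx=\inf_{n\ge1}\frac1n\int_{\mathbb{R}/\mathbb{Z}}\log\|A_n^{(E-\lambda v)}(x)\|\,dx\ge0,$$ where $dx$ is Lebesgue measure and $\|\cdot\|$ is the operator norm; the limit exists by subadditivity. *)

(* Defs.v *)
From mathcomp Require Import all_boot all_order all_algebra.
From mathcomp Require Import all_classical all_reals all_analysis.

Set Implicit Arguments.
Unset Strict Implicit.
Unset Printing Implicit Defensive.

Import Order.TTheory GRing.Theory Num.Theory.
Import numFieldNormedType.Exports.

Local Open Scope classical_set_scope.
Local Open Scope ring_scope.

(* Functions on the circle R/Z are represented by 1-periodic functions on R;
   the doubling map then lifts to x |-> 2 * x, and Lebesgue measure on R/Z is
   Lebesgue measure on the fundamental domain [0, 1). *)
Definition circle_fun (R : realType) (T : Type) (f : R -> T) : Prop :=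
  forall x, f (x + 1) = f x.

Definition doubling (R : realType) (x : R) : R := 2 * x.

Definition euclidean_norm (R : realType) (n : nat) (u : 'cV[R]_n) : R :=
  Num.sqrt (\sum_(i < n) u i 0 ^+ 2).

(* The library norm on matrices is the entrywise maximum, not this one. *)
Definition operator_norm (R : realType) (n : nat) (A : 'M[R]_n) : R :=
  sup [set euclidean_norm (A *m u) | u in [set u | euclidean_norm u = 1]].

(* (w(x), -1; 1, 0) *)
Definition schrodinger_cocycle (R : realType) (w : R -> R) (x : R) : 'M[R]_2 :=
  \matrix_(i < 2, j < 2)
    nth 0 (nth [::] [:: [:: w x; -1]; [:: 1; 0]] i) j.

Fixpoint cocycle_iter (R : realType) (d : nat) (A : R -> 'M[R]_d) (n : nat)
    (x : R) : 'M[R]_d :=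
  if n is m.+1 then A (iter m (@doubling R) x) *m cocycle_iter A m x
  else 1%:M.

(* The term of index 0 is irrelevant to the limit (0^-1 = 0).  For bounded
   measurable v the integrals are finite and the limit exists, by
   subadditivity. *)
Definition lyapunov_exponent (R : realType) (v : R -> R) (E lambda : R) : R :=
  limn (fun n : nat => n%:R^-1 *
    (\int[@lebesgue_measure R]_(x in `[0, 1[)
      ln (operator_norm
        (cocycle_iter (schrodinger_cocycle (fun y => E - lambda * v y)) n x)))).

(* Main.v *)
Require Import Defs.
From mathcomp Require Import all_boot all_order all_algebra.
From mathcomp Require Import all_classical all_reals all_analysis.
From mathcomp Require Import measurable_realfun.
From mathcomp Require Import ring lra zify.
Import Order.TTheory GRing.Theory Num.Theory.
Import numFieldNormedType.Exports.
Local Open Scope classical_set_scope.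
Local Open Scope ring_scope.

(** Write w = E - lambda v, and let u_n(x) be the solution of the eigenvalue
    equation with u_(-1) = 0 and u_0 = 1, that is, the upper left entry of
    A_n(x).  Since ||A_n|| is at least of the order of |u_n|, and |u_n| is the
    product of the Riccati quotients r_k = u_(k+1) / u_k for k < n, it is
    enough that each r_k is rarely much smaller than lambda: if
    |{x : |r_k(x)| <= t}| <= K t / lambda for all t, with K depending only on v,
    then the integral of log |r_k| is at least log lambda - C, and summing
    over k < n gives the theorem.

    The derivative of v is continuous and bounded away from 0, so it has
    constant sign, and up to replacing w by -w (which only changes the signs of
    the u_n) w has slope at least c = lambda inf |v'| on [0, 1).  The quotients
    satisfy r_0 = w and r_(k+1)(x) = w(2^(k+1) x) - 1 / r_k(x).  Seen as a map
    into the projective line, - 1 / r_k moves in the same direction as r_k, and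
    that is the direction of w: both terms cooperate, so r_k increases with
    slope at least c 2^k on every interval without pole or discontinuity, and
    such an interval contributes at most 2 t / (c 2^k) to the measure of
    {|r_k| <= t}.

    It remains to see that there are only about 2^k such intervals (branches).
    The poles of r_(k+1) are the zeros of r_k; a pole of r_k is not one of
    r_(k+1), because - 1 / r_k passes through 0 there, increasing.  Hence each
    step splits a branch at a zero of r_k, but glues its right part to the left
    part of the next branch: the label of a branch grows by [r_k > 0], besides
    the jumps of w(2^(k+1) x).  This gives the labelling [branch], which is
    nondecreasing ([riccati_monotone]) and takes fewer than 2^(k+1) values
    ([branch_bound]).  Multiplying, |{|r_k| <= t}| <= 4 t / c
    ([measure_small_ratio]); the points where some u_j vanishes are excluded
    from the monotonicity argument and form a null set ([measure_vanishing]).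

    The Lyapunov exponent is defined as a limit, whose existence has to be
    shown: the integrals of log ||A_n|| are, up to a bounded error, subadditive
    because the doubling map preserves Lebesgue measure ([mean_growthD]), and
    the classical lemma of Fekete applies ([fekete_cvg]).  The bounded error
    comes from replacing the operator norm by the sum of the absolute values of
    the entries. *)

Set Implicit Arguments.
Unset Strict Implicit.
Unset Printing Implicit Defensive.

(** * Solutions, Riccati quotients and their branches *)

Definition expanding (R : realType) (c : R) (w : R -> R) : Prop :=
  forall x y, 0 <= x -> x <= y -> y < 1 -> c * (y - x) <= w y - w x.

(** The value u_n(x) at site n of the solution of the eigenvalue equation
    normalised by u_(-1) = 0 and u_0 = 1. *)
Definition dirichlet (R : realType) (w : R -> R) (n : nat) (x : R) : R :=
  cocycle_iter (schrodinger_cocycle w) n x 0 0.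

Lemma iter_doubling (R : realType) n (x : R) :
  iter n (@doubling R) x = 2 ^+ n * x.
Proof.
elim: n => [|n IH] /=; first by rewrite mul1r.
by rewrite IH /doubling mulrA -exprS.
Qed.

Lemma mul2mxE (R : realType) m n (A : 'M[R]_(m, 2)) (B : 'M[R]_(2, n)) i j :
  (A *m B) i j = A i 0 * B 0 j + A i 1 * B 1 j.
Proof.
rewrite mxE big_ord_recl big_ord1; congr (_ * _ + _ * _); congr (_ _ _).
all: by apply: val_inj.
Qed.

Lemma dirichlet0 (R : realType) (w : R -> R) x : dirichlet w 0 x = 1.
Proof. by rewrite /dirichlet /= mxE. Qed.

Lemma dirichlet1 (R : realType) (w : R -> R) x : dirichlet w 1 x = w x.
Proof. by rewrite /dirichlet /= mulmx1 mxE. Qed.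

Lemma cocycle_iterS (R : realType) d (A : R -> 'M[R]_d) n x :
  cocycle_iter A n.+1 x = A (2 ^+ n * x) *m cocycle_iter A n x.
Proof. by rewrite -iter_doubling. Qed.

Lemma dirichlet_rec (R : realType) (w : R -> R) n x :
  dirichlet w n.+2 x =
  w (2 ^+ n.+1 * x) * dirichlet w n.+1 x - dirichlet w n x.
Proof.
have -> : dirichlet w n x = cocycle_iter (schrodinger_cocycle w) n.+1 x 1 0.
  by rewrite cocycle_iterS mul2mxE !mxE /= mul0r addr0 mul1r.
rewrite /dirichlet cocycle_iterS mul2mxE; set B := cocycle_iter _ n.+1 x.
by rewrite !mxE /= mulN1r.
Qed.

Lemma circle_fun_natD (R : realType) (T : Type) (f : R -> T) (x : R) (n : nat) :
  circle_fun f -> f (x + n%:R) = f x.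
Proof.
move=> fper; elim: n => [|n IH]; first by rewrite addr0.
by rewrite -addn1 natrD addrA fper.
Qed.

(** Two points whose images under x |-> 2^k x lie in the same unit interval see
    the same copy of w, run through 2^k times faster. *)
Lemma expanding_iter (R : realType) (c : R) (w : R -> R) (k : nat) (x y : R) :
  circle_fun w -> expanding c w -> 0 <= x -> x <= y ->
  Num.truncn (2 ^+ k * x) = Num.truncn (2 ^+ k * y) ->
  c * 2 ^+ k * (y - x) <= w (2 ^+ k * y) - w (2 ^+ k * x).
Proof.
move=> wper wexp x0 xy.
have K0 : 0 <= 2 ^+ k :> R by rewrite exprn_ge0.
set X := 2 ^+ k * x; set Y := 2 ^+ k * y => XY.
have X0 : 0 <= X by rewrite mulr_ge0.
have Y0 : 0 <= Y by rewrite mulr_ge0// (le_trans x0).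
have XleY : X <= Y by rewrite ler_wpM2l.
have /andP[X1 X2] := truncn_itv X0; have /andP[Y1 Y2] := truncn_itv Y0.
have wE Z n : w Z = w (Z - n%:R) by rewrite -[in LHS](subrK n%:R Z) circle_fun_natD.
rewrite (wE Y (Num.truncn Y)) (wE X (Num.truncn X)).
apply: le_trans (wexp _ _ _ _ _); rewrite ?subr_ge0//.
- by rewrite -mulrA XY /X /Y; rewrite le_eqVlt; apply/orP; left; apply/eqP; ring.
- by rewrite XY lerD2r.
- by rewrite ltrBlDr addrC natr1.
Qed.

(** With 1/0 = 0, the quotient is 0 at a zero of u_n; then [riccati_rec] still
    holds there as soon as u_(n+1) does not vanish. *)
Definition riccati (R : realType) (w : R -> R) (n : nat) (x : R) : R :=
  dirichlet w n.+1 x / dirichlet w n x.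

Lemma riccati_rec (R : realType) (w : R -> R) n x :
  dirichlet w n.+1 x != 0 ->
  riccati w n.+1 x = w (2 ^+ n.+1 * x) - (riccati w n x)^-1.
Proof.
by move=> un0; rewrite /riccati dirichlet_rec mulrDl mulfK// mulNr invf_div.
Qed.

(** Label of the interval of continuity and monotonicity of r_k that contains x.
    Passing from r_k to r_(k+1), the label changes at the zeros of r_k, which
    become poles, and at the jumps of w(2^(k+1) x); it should not change at a
    pole of r_k.  Adding [0 < r_k x] does both at once: this indicator jumps up
    at a zero, and at a pole it drops by one exactly when the old label
    increases by one. *)
Fixpoint branch (R : realType) (w : R -> R) (k : nat) (x : R) : nat :=
  if k is m.+1 then
    (branch w m x + (0 < riccati w m x)%R + Num.truncn (2 ^+ k * x))%N
  else 0.

(** By induction 2^(k+1) - 1 is an upper bound: each step adds at most one for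
    the sign and at most 2^(k+1) - 1 for the integer part. *)
Lemma branch_bound (R : realType) (w : R -> R) (k : nat) (x : R) :
  0 <= x < 1 -> (branch w k x < 2 ^ k.+1)%N.
Proof.
move=> /andP[x0 x1]; elim: k => [//|k IH].
have lt_double (a t P : nat) (b : bool) :
    (a < P)%N -> (t < P)%N -> (a + b + t < 2 * P)%N.
  by clear; case: b => /=; lia.
rewrite /= expnS; apply: lt_double => //.
rewrite truncn_lt_nat ?mulr_ge0 ?exprn_ge0// natrX.
by rewrite -[ltRHS]mulr1 ltr_pM2l// exprn_gt0.
Qed.

(** Both claims are proved together, since the label at step k+1 is monotone
    because r_k is.  Within one branch of r_(k+1), either x and y lie in the same
    branch of r_k and r_k has the same sign at both, so that - 1 / r_k increases
    from x to y; or y lies in the next branch, and the labels agree only if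
    r_k x > 0 >= r_k y, so that - 1 / r_k passes from negative to nonnegative
    values.  In both cases the increment of w(2^(k+1) x) is only helped. *)
Lemma riccati_monotone (R : realType) (c : R) (w : R -> R) (k : nat) (x y : R) :
  0 < c -> circle_fun w -> expanding c w ->
  0 <= x -> x <= y -> y < 1 ->
  (forall j, (j <= k)%N -> dirichlet w j x != 0 /\ dirichlet w j y != 0) ->
  (branch w k x <= branch w k y)%N /\
  (branch w k x = branch w k y ->
    c * 2 ^+ k * (y - x) <= riccati w k y - riccati w k x).
Proof.
move=> c0 wper wexp x0 xy y1; elim: k => [|k IH] nz.
  split=> // _.
  rewrite /riccati !dirichlet0 !divr1 !dirichlet1 expr0 mulr1.
  exact: wexp.
have {}/IH[bmono rmono] : forall j, (j <= k)%N ->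
    dirichlet w j x != 0 /\ dirichlet w j y != 0.
  by move=> j jk; apply: nz; rewrite leqW.
have [xnz ynz] := nz _ (leqnn k.+1).
have [xnz' ynz'] := nz _ (leqnSn k).
have tmono : (Num.truncn (2 ^+ k.+1 * x) <= Num.truncn (2 ^+ k.+1 * y))%N.
  by apply: le_truncn; rewrite ler_wpM2l// exprn_ge0.
have rx0 : riccati w k x != 0 by rewrite mulf_neq0// invr_neq0.
have ry0 : riccati w k y != 0 by rewrite mulf_neq0// invr_neq0.
have qmono : (branch w k x + (0 < riccati w k x)%R
    <= branch w k y + (0 < riccati w k y)%R)%N.
  have [e|] := eqVneq (branch w k x) (branch w k y); last first.
    move=> ne; have lt : (branch w k x < branch w k y)%N by rewrite ltn_neqAle ne.
    by apply: leq_trans (leq_addr _ _); apply: leq_trans lt; rewrite -addn1 leq_add2l leq_b1.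
  have := rmono e; have : 0 <= c * 2 ^+ k * (y - x).
    by rewrite !mulr_ge0 ?subr_ge0 ?exprn_ge0// ltW.
  rewrite e leq_add2l => d0 d1.
  by case: (ltP 0 (riccati w k x)) => // rx; case: ltP => // ry; exfalso; lra.
split; first exact: leq_add.
move=> /= e.
have te : Num.truncn (2 ^+ k.+1 * x) = Num.truncn (2 ^+ k.+1 * y).
  by clear -e qmono tmono; lia.
have qe : (branch w k x + (0 < riccati w k x)%R
    = branch w k y + (0 < riccati w k y)%R)%N by clear -e te; lia.
rewrite !riccati_rec//.
have := expanding_iter wper wexp x0 xy te.
suff : 0 <= (riccati w k x)^-1 - (riccati w k y)^-1.
  by move=> h1 h2; apply: le_trans h2 _; lra.
have [e1|ne] := eqVneq (branch w k x) (branch w k y).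
  have := rmono e1; have d0 : 0 <= c * 2 ^+ k * (y - x).
    by rewrite !mulr_ge0 ?subr_ge0 ?exprn_ge0// ltW.
  move=> /(le_trans d0) rxy.
  have -> : (riccati w k x)^-1 - (riccati w k y)^-1 =
      (riccati w k y - riccati w k x) / (riccati w k x * riccati w k y).
    by field; rewrite ry0 rx0.
  rewrite divr_ge0//.
  move: qe; rewrite e1 => /addnI.
  case: (ltP 0 (riccati w k x)) => rx; case: (ltP 0 (riccati w k y)) => ry // _.
    by rewrite mulr_ge0// ltW.
  by rewrite mulr_le0.
move: qe; case: (ltP 0 (riccati w k x)) => rx; case: (ltP 0 (riccati w k y)) => ry /=;
  try by clear -ne bmono; lia.
by move=> _; rewrite subr_ge0 (@le_trans _ _ 0)// ?invr_le0// invr_ge0 ltW.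
Qed.

(** * Potentials with derivative bounded away from zero *)

(** The mean value theorem covers 0 < x; the limit at 0 from the right brings in
    the left endpoint. *)
Lemma expanding_of_derivative (R : realType) (c : R) (f : R -> R) :
  (forall x : R, x \in `]0, 1[ -> derivable f x 1) ->
  (forall x : R, x \in `]0, 1[ -> c <= derive1 f x) ->
  f x @[x --> (0 : R)^'+] --> f 0 ->
  expanding c f.
Proof.
move=> fd f' f0.
have int x y : 0 < x -> x <= y -> y < 1 -> c * (y - x) <= f y - f x.
  move=> x0; rewrite le_eqVlt => /predU1P[<- _|xy y1].
    by rewrite !subrr mulr0.
  have sub z : z \in `[x, y] -> z \in `]0, 1[.
    by rewrite !in_itv /= => /andP[xz zy]; rewrite (lt_le_trans x0)// (le_lt_trans zy).
  have [||z zxy ->] := @MVT R f (derive1 f) x y xy.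
  - move=> z zxy; rewrite derive1E; apply/derivableP/fd/sub.
    exact: subset_itv_oo_cc.
  - by apply: derivable_within_continuous => z /sub/fd.
  - rewrite ler_wpM2r ?subr_ge0 ?(ltW xy)//; apply/f'/sub.
    exact: subset_itv_oo_cc.
move=> x y; rewrite le_eqVlt => /predU1P[<-|x0]; last exact: int.
rewrite le_eqVlt => /predU1P[<- _|y0 y1]; first by rewrite !subrr mulr0.
rewrite lerBrDr.
have cvl : c * (y - x) + f x @[x --> (0 : R)^'+] --> c * (y - 0) + f 0.
  apply: cvgD => //; apply: cvgMr; apply: cvgB; first exact: cvg_cst.
  exact: cvg_at_right_filter.
apply: ler_cvg_to cvl (cvg_cst (f y)) _.
near=> z; rewrite -lerBrDr; apply: int => //; near: z.
exact: nbhs_right_le.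
Unshelve. all: by end_near. Qed.

(** A change of sign would produce a zero of g, by the intermediate value
    theorem. *)
Lemma derivative_constant_sign (R : realType) (g : R -> R) (c : R) :
  0 < c -> {in `]0, 1[, continuous g} ->
  (forall x, x \in `]0, 1[ -> c <= `|g x|) ->
  (forall x, x \in `]0, 1[ -> c <= g x) \/ (forall x, x \in `]0, 1[ -> g x <= - c).
Proof.
move=> c0 gc gabs.
have nozero x y : x \in `]0, 1[ -> y \in `]0, 1[ -> g x <= 0 -> 0 <= g y -> False.
  move=> xI yI gx gy.
  pose a := Num.min x y; pose b := Num.max x y.
  have ab : a <= b by rewrite /a /b ge_min le_max lexx.
  have sub z : z \in `[a, b] -> z \in `]0, 1[.
    move: xI yI; rewrite !in_itv /= => /andP[x0 x1] /andP[y0 y1] /andP[az zb].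
    by rewrite (lt_le_trans _ az) ?lt_min ?x0// (le_lt_trans zb)// gt_max x1.
  have gcab : {within `[a, b], continuous g}.
    by apply: continuous_in_subspaceT => z; rewrite inE => /sub/gc.
  have [|z zI gz] := @IVT R g a b 0 ab gcab.
    rewrite /a /b; case: (leP x y) => _; rewrite ge_min le_max gx gy ?orbT//.
  by have := gabs z (sub _ zI); rewrite gz normr0 leNgt c0.
have hI : (2^-1 : R) \in `]0, 1[ by rewrite in_itv /=; apply/andP; split; lra.
have [h|h] := leP 0 (g 2^-1).
  left=> x xI; have := gabs x xI; case: (leP 0 (g x)) => [/ger0_norm->//|/ltW gx].
  by have := nozero _ _ xI hI gx h.
right=> x xI; have := gabs x xI.
case: (leP 0 (g x)) => [gx|gx].
  by have := nozero _ _ hI xI (ltW h) gx.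
by rewrite ltr0_norm// lerNr.
Qed.

Lemma circle_fun_intD (R : realType) (T : Type) (f : R -> T) (x : R) (n : int) :
  circle_fun f -> f (x + n%:~R) = f x.
Proof.
move=> fper; case: n => n; first exact: circle_fun_natD.
by rewrite NegzE mulrNz -[in RHS](subrK n.+1%:R x) circle_fun_natD.
Qed.

(** The function factors through the fractional part, and the floor is
    measurable because it is nondecreasing. *)
Lemma measurable_circle_fun (R : realType) (f : R -> R) :
  circle_fun f -> measurable_fun `[(0 : R), 1[ f -> measurable_fun setT f.
Proof.
move=> fper mf.
have -> : f = f \o (fun x => x - (Num.floor x)%:~R).
  by apply/funext => x /=; rewrite -mulrNz circle_fun_intD.
apply: (@measurable_comp _ _ _ _ _ _ `[(0 : R), 1[) => //.
  move=> _ [x _ <-] /=; rewrite in_itv /= subr_ge0 floor_le ltrBlDl.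
  by have := floor_itv x; rewrite intrD addrC => /andP[_].
apply: measurable_funB => //; apply: nondecreasing_measurable => // x y xy.
by rewrite ler_int le_floor.
Qed.

Lemma measurable_of_continuous_itvoo (R : realType) (f : R -> R) :
  {in `]0, 1[, continuous f} -> measurable_fun `[(0 : R), 1[ f.
Proof.
move=> fc; rewrite -(@setU1itv _ _ (BLeft 1) 0 false) ?bnd_simp//.
apply/measurable_funU => //; split; first exact: measurable_fun_set1.
by apply: open_continuous_measurable_fun => // x; rewrite inE => /fc.
Qed.

(** * Distribution of the Riccati quotients *)

(** The infimum of P is a left endpoint that works. *)
Lemma sub_itv_of_diameter (R : realType) (P : set R) (d : R) :
  (forall x y, P x -> P y -> x <= y -> y - x <= d) ->
  exists a, P `<=` `[a, a + d].
Proof.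
move=> Pd; have [->|/set0P[z Pz]] := eqVneq P set0; first by exists 0.
have d0 : 0 <= d by have := Pd _ _ Pz Pz (lexx z); rewrite subrr.
have dist x y : P x -> P y -> x - d <= y.
  move=> Px Py; case: (leP x y) => xy; first by rewrite lerBlDr (le_trans xy)// lerDl.
  by rewrite lerBlDr -lerBlDl; apply: Pd => //; exact: ltW.
exists (inf P) => x Px /=; rewrite in_itv /=; apply/andP; split.
  by apply: ge_inf => //; exists (z - d) => y Py; exact: dist.
by rewrite -lerBlDr; apply: lb_le_inf; [exists z|move=> y Py; exact: dist].
Qed.

Section distribution.
Context {R : realType}.
Local Notation mu := (@lebesgue_measure R).
Implicit Types (w : R -> R) (c t : R).

Lemma dirichletN w n x :
  dirichlet (fun y => - w y) n x = (-1) ^+ n * dirichlet w n x.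
Proof.
suff : dirichlet (fun y => - w y) n x = (-1) ^+ n * dirichlet w n x /\
    dirichlet (fun y => - w y) n.+1 x = (-1) ^+ n.+1 * dirichlet w n.+1 x by case.
elim: n => [|n [IH0 IH1]].
  by rewrite !dirichlet0 !dirichlet1 expr0 expr1 mul1r mulN1r.
split=> //; rewrite !dirichlet_rec IH1 IH0 !exprS; ring.
Qed.

Lemma measurable_dirichlet w n :
  measurable_fun setT w -> measurable_fun setT (dirichlet w n).
Proof.
move=> mw.
suff : measurable_fun setT (dirichlet w n) /\ measurable_fun setT (dirichlet w n.+1).
  by case.
elim: n => [|n [IH0 IH1]].
  have -> : dirichlet w 0 = cst 1 by apply/funext => x; rewrite dirichlet0.
  have -> : dirichlet w 1 = w by apply/funext => x; rewrite dirichlet1.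
  by split.
split=> //.
have -> : dirichlet w n.+2 =
    fun x => w (2 ^+ n.+1 * x) * dirichlet w n.+1 x - dirichlet w n x.
  by apply/funext => x; rewrite dirichlet_rec.
apply: measurable_funB => //; apply: measurable_funM => //.
by apply: measurableT_comp => //; exact: measurable_funM.
Qed.

(** The set where |r_k| <= t, written without division so that it makes sense
    at the zeros of u_k too. *)
Definition small_ratio w k t : set R :=
  [set x | 0 <= x < 1 /\ `|dirichlet w k.+1 x| <= t * `|dirichlet w k x|].

Definition vanishing w k : set R :=
  [set x | 0 <= x < 1 /\ exists2 j, (j <= k)%N & dirichlet w j x = 0].

Lemma measurable_small_ratio w k t :
  measurable_fun setT w -> measurable (small_ratio w k t).
Proof.
move=> mw; have mU := fun n => measurable_dirichlet n mw.
rewrite (_ : small_ratio w k t = `[0, 1[ `&`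
  (fun x => t * `|dirichlet w k x| - `|dirichlet w k.+1 x|) @^-1` `[0, +oo[).
  apply: measurableI => //; rewrite -[X in measurable X]setTI.
  apply: measurable_funB => //; first by apply: measurable_funM => //; exact: measurableT_comp.
  exact: measurableT_comp.
apply/seteqP; split => x /=; rewrite in_itv/= in_itv/= andbT subr_ge0; exact.
Qed.

Lemma measurable_vanishing w k : measurable_fun setT w -> measurable (vanishing w k).
Proof.
move=> mw; have mU := fun n => measurable_dirichlet n mw.
rewrite (_ : vanishing w k = `[0, 1[ `&`
  \bigcup_(j in [set j | (j <= k)%N]) (dirichlet w j) @^-1` [set 0]).
  apply: measurableI => //; apply: bigcup_measurable => j _.
  by rewrite -[X in measurable X]setTI; exact: mU.
apply/seteqP; split => x /=; rewrite in_itv/=.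
  by move=> [h [j jk e]]; split=> //; exists j.
by move=> [h [j jk e]]; split=> //; exists j.
Qed.

(** On one branch r_k has slope at least c 2^k, so the part where it ranges in
    [-t, t] has diameter at most 2 t / (c 2^k). *)
Lemma small_ratio_cover w c k t : 0 < c -> circle_fun w -> expanding c w ->
  exists a : nat -> R, small_ratio w k t `<=`
    vanishing w k `|` \big[setU/set0]_(i < (2 ^ k.+1)%N) `[a i, a i + 2 * t / (c * 2 ^+ k)]%classic.
Proof.
move=> c0 wper wexp.
pose P (i : nat) := [set x | (small_ratio w k t `\` vanishing w k) x /\ branch w k x = i].
have cK : 0 < c * 2 ^+ k by rewrite mulr_gt0// exprn_gt0.
have /choice[a aP] i : exists a, P i `<=` `[a, a + 2 * t / (c * 2 ^+ k)].
  apply: sub_itv_of_diameter => x y [[[/andP[x0 x1] xt] xnv] xi] [[[/andP[y0 y1] yt] ynv] yi] xy.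
  have nv z : 0 <= z -> z < 1 -> ~ vanishing w k z -> forall j, (j <= k)%N -> dirichlet w j z != 0.
    move=> z0 z1 znv j jk; apply/eqP => e; apply: znv; split; [by rewrite z0|by exists j].
  have [j|_] := riccati_monotone c0 wper wexp x0 xy y1 (k := k).
    by move=> jk; split; exact: nv.
  rewrite xi yi => /(_ erefl) h.
  have small z : 0 <= z -> z < 1 -> ~ vanishing w k z ->
      `|dirichlet w k.+1 z| <= t * `|dirichlet w k z| -> `|riccati w k z| <= t.
    move=> z0 z1 znv zt; rewrite normrM normfV ler_pdivrMr// normr_gt0; exact: nv.
  have := small _ x0 x1 xnv xt; have := small _ y0 y1 ynv yt.
  rewrite !ler_norml => /andP[_ r1] /andP[r2 _].
  by rewrite ler_pdivlMr// mulrC; apply: le_trans h _; lra.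
exists a => x xS; have [v|nv] := pselect (vanishing w k x); [by left|right].
rewrite -(bigcup_mkord _ (fun i => `[a i, a i + 2 * t / (c * 2 ^+ k)]%classic)).
exists (branch w k x) => /=; last exact: aP.
by apply: branch_bound; case: xS.
Qed.

(** There are 2^(k+1) intervals of length 2 t / (c 2^k): the powers of 2
    cancel, and the bound is uniform in k. *)
Lemma measure_small_ratio_vanishing w c k t : 0 < c -> 0 <= t -> circle_fun w ->
  measurable_fun setT w -> expanding c w ->
  (mu (vanishing w k `|` small_ratio w k t) <= mu (vanishing w k) + (4 * t / c)%:E)%E.
Proof.
move=> c0 t0 wper mw wexp.
have [a aP] := @small_ratio_cover w c k t c0 wper wexp.
have mV := measurable_vanishing k mw.
set d := 2 * t / (c * 2 ^+ k) in aP.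
have d0 : 0 <= d by rewrite !mulr_ge0// invr_ge0 mulr_ge0 ?exprn_ge0// ltW.
set C := \big[setU/set0]_(i < _) _ in aP.
have mC : measurable C by apply: bigsetU_measurable.
apply: (@le_trans _ _ (mu (vanishing w k `|` C))).
  apply: le_measure; rewrite ?inE; [apply: measurableU => //|exact: measurableU|].
    exact: measurable_small_ratio.
  by rewrite subUset; split=> //; exact: subsetUl.
have hU : (mu (vanishing w k `|` C) <= mu (vanishing w k) + mu C)%E by exact: measureU2.
apply: (le_trans hU); rewrite leeD2l//.
apply: (le_trans (@Boole_inequality _ _ _ mu (fun i => `[a i, a i + d]%classic) _ _)) => //.
have hI i : mu `[a i, a i + d]%classic = d%:E.
  rewrite lebesgue_measure_itv /= lte_fin; case: ifP => [_|/negbT].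
    by rewrite -EFinB addrAC subrr add0r.
  rewrite -leNgt gerDl => dle; congr EFin; apply/eqP.
  by rewrite eq_le d0 dle.
rewrite (eq_bigr (fun=> d%:E)) => [|i _]; last exact: hI.
rewrite sumEFin lee_fin sumr_const card_ord -[d *+ _]mulr_natl natrX /d.
rewrite le_eqVlt; apply/orP; left; apply/eqP; rewrite exprS.
by field; rewrite (gt_eqF c0) expf_neq0.
Qed.

(** A zero of u_(k+1) belongs to the set where |r_k| <= t for every t, whose
    measure tends to 0 with t once the zeros of the earlier u_j are known to be
    negligible. *)
Lemma measure_vanishing w c k : 0 < c -> circle_fun w ->
  measurable_fun setT w -> expanding c w -> mu (vanishing w k) = 0%E.
Proof.
move=> c0 wper mw wexp; elim: k => [|k IH].
  rewrite (_ : vanishing w 0 = set0) ?measure0//; apply/seteqP; split=> // x [_ [[]//= _]].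
  by rewrite dirichlet0 => /eqP; rewrite oner_eq0.
apply/eqP; rewrite eq_le measure_ge0 andbT; apply/lee_addgt0Pr => e e0.
rewrite add0e; pose t := e * c / 4.
have t0 : 0 <= t by rewrite !mulr_ge0// ltW.
have := measure_small_ratio_vanishing k c0 t0 wper mw wexp.
rewrite IH add0e (_ : 4 * t / c = e); last by rewrite /t; field; rewrite gt_eqF.
apply: le_trans; apply: le_measure; rewrite ?inE.
- exact: measurable_vanishing.
- by apply: measurableU; [exact: measurable_vanishing|exact: measurable_small_ratio].
move=> x [x01 [j]]; rewrite leq_eqVlt => /predU1P[->|jk] e1.
  by right; split=> //; rewrite e1 normr0 mulr_ge0.
by left; split=> //; exists j.
Qed.

(** Changing w into -w only changes the signs of the u_n, so decreasing
    potentials reduce to increasing ones. *)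
Lemma measure_small_ratio w c k t : 0 < c -> 0 <= t -> circle_fun w ->
  measurable_fun setT w -> expanding c w \/ expanding c (fun x => - w x) ->
  (mu (small_ratio w k t) <= (4 * t / c)%:E)%E.
Proof.
move=> c0 t0.
wlog wexp : w / expanding c w => [hw wper mw [] wexp|wper mw _].
- by apply: hw => //; left.
- rewrite (_ : small_ratio w k t = small_ratio (fun x => - w x) k t).
    apply: hw => //; [by move=> x; rewrite wper|exact: measurableT_comp|by left].
  by rewrite /small_ratio; under [in RHS]eq_fun do rewrite !dirichletN !normrM !normrX normrN1 !expr1n !mul1r.
have := measure_small_ratio_vanishing k c0 t0 wper mw wexp.
rewrite (measure_vanishing k c0 wper mw wexp) add0e; apply: le_trans.
have mS := measurable_small_ratio k t mw.
apply: le_measure; rewrite ?inE//.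
by apply: measurableU => //; exact: measurable_vanishing.
Qed.

End distribution.

(** * Logarithmic loss caused by small quotients *)

Section penalty.
Context {R : realType}.
Local Notation mu := (@lebesgue_measure R).
Implicit Types (w : R -> R) (c t lambda : R).

Lemma dyadic_log_bound (s : R) : 0 < s ->
  exists m : nat, (forall i, (i < m)%N -> (2 ^ (i + 1))%:R <= s) /\
    ln s <= m.+1%:R * ln 2.
Proof.
move=> s0.
have ln20 : 0 <= ln 2 :> R by rewrite ln_ge0// ler1n.
have ex : exists N, s < (2 ^ N)%:R.
  exists (Num.truncn s).+1; have /andP[_ h] := truncn_itv (ltW s0).
  by apply: lt_trans h _; rewrite ltr_nat ltn_expl.
(* the least N with s < 2^N; the threshold count is N - 1, or 0 when s < 1 *)
have [[|m] sN Nmin] := ex_minnP ex.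
  by exists 0%N; split=> //; rewrite mul1r (le_trans _ ln20)// ln_le0// ltW.
exists m; split => [i im|].
  have : ~~ (s < (2 ^ m)%:R) by apply/negP => /Nmin; rewrite ltnn.
  rewrite -leNgt; apply: le_trans.
  by rewrite ler_nat leq_exp2l// addn1.
rewrite mulr_natl -lnXn// ler_ln ?posrE ?exprn_gt0//.
by rewrite -natrX ltW.
Qed.

Local Open Scope ereal_scope.

(** A version of the positive part of log (lambda / |r_k|), rounded down to a
    multiple of log 2: one term log 2 for each dyadic threshold lambda / 2^(i+1)
    that |r_k| does not exceed.  Its integral is then a series of measures. *)
Definition penalty w lambda k (x : R) : \bar R :=
  \sum_(0 <= i <oo) (ln (2 : R) * \1_(small_ratio w k (lambda / (2 ^ (i + 1))%:R)) x)%R%:E.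

Let term_ge0 w lambda k x i :
  0 <= (ln (2 : R) * \1_(small_ratio w k (lambda / (2 ^ (i + 1))%:R)) x)%R%:E.
Proof. by rewrite lee_fin mulr_ge0// ln_ge0// ler1n. Qed.

Lemma penalty_ge0 w lambda k x : 0 <= penalty w lambda k x.
Proof. by apply: nneseries_ge0 => i _ _; exact: term_ge0. Qed.

Lemma measurable_penalty w lambda k (D : set R) :
  measurable_fun setT w -> measurable_fun D (penalty w lambda k).
Proof.
move=> mw; apply: ge0_emeasurable_sum => [i x _ _|i _]; first exact: term_ge0.
apply/measurable_EFinP; apply: measurable_funM => //.
by apply: measurable_indic; exact: measurable_small_ratio.
Qed.

(** The i-th threshold contributes ln 2 times 4 lambda / (c 2^(i+1)), and these
    form a geometric series. *)
Lemma integral_penalty w c lambda k :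
  (0 < c)%R -> (0 < lambda)%R -> circle_fun w -> measurable_fun setT w ->
  expanding c w \/ expanding c (fun x => - w x)%R ->
  \int[mu]_(x in `[0%R, 1%R[) penalty w lambda k x <= (4 * ln 2 * lambda / c)%:E.
Proof.
move=> c0 l0 wper mw wexp.
have ln20 : (0 <= ln 2 :> R)%R by rewrite ln_ge0// ler1n.
rewrite integral_nneseries//; last first.
  move=> i; apply/measurable_EFinP; apply: measurable_funM => //.
  by apply: measurable_indic; exact: measurable_small_ratio.
have := cvg_lim (@ereal_hausdorff R)
  (@cvg_geometric_eseries_half R (4 * ln 2 * lambda / c)%R 0%N).
rewrite expr0 divr1 => <-.
apply: lee_nneseries => [i _ _|i _]; first by apply: integral_ge0 => x _.
under eq_integral do rewrite EFinM.
rewrite ge0_integralZl_EFin//; last first.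
  apply/measurable_EFinP; apply: measurable_indic; exact: measurable_small_ratio.
rewrite integral_indic//; last exact: measurable_small_ratio.
rewrite setIidl; last by move=> x [h _]; rewrite /= in_itv.
have t0 : (0 <= lambda / (2 ^ (i + 1))%:R)%R by rewrite divr_ge0 ?ltW.
apply: (@le_trans _ _ ((ln 2)%:E * (4 * (lambda / (2 ^ (i + 1))%:R) / c)%:E)).
  by rewrite lee_wpmul2l ?lee_fin//; exact: measure_small_ratio.
by rewrite -EFinM lee_fin le_eqVlt; apply/orP; left; apply/eqP; ring.
Qed.

Lemma le_penalty w lambda k x m :
  (forall i, (i < m)%N -> small_ratio w k (lambda / (2 ^ (i + 1))%:R) x) ->
  (m%:R * ln 2)%:E <= penalty w lambda k x.
Proof.
move=> h; rewrite /penalty.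
apply: le_trans (nneseries_lim_ge m (fun i _ _ => term_ge0 w lambda k x i)).
rewrite big_mkord (eq_bigr (fun=> (ln 2)%:E)) => [|i _]; last first.
  by rewrite indicE mem_set ?mulr1//; exact: h.
by rewrite sumEFin sumr_const card_ord mulr_natl.
Qed.

(** At a zero of u_(k+1) all the thresholds are met. *)
Lemma penalty_vanishing w lambda k x : (0 <= x < 1)%R -> (0 < lambda)%R ->
  dirichlet w k.+1 x = 0%R -> penalty w lambda k x = +oo.
Proof.
move=> x01 l0 u0; have ln20 : (0 < ln 2 :> R)%R by rewrite ln_gt0// ltr1n.
apply: eq_infty => r; apply: le_trans (le_penalty (m := (Num.truncn (r / ln 2)).+1) _).
  rewrite lee_fin -ler_pdivrMr//.
  have [r0|r0] := leP 0%R (r / ln 2)%R; last by rewrite (le_trans (ltW r0)).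
  by have /andP[_ /ltW] := truncn_itv r0.
move=> i _; split=> //; rewrite u0 normr0 mulr_ge0// divr_ge0//; exact: ltW.
Qed.

(** Rounding down to a multiple of log 2 loses at most log 2, which accounts for
    the term - ln 2. *)
Lemma penalty_step w lambda k x : (0 <= x < 1)%R -> (0 < lambda)%R ->
  dirichlet w k x != 0%R -> dirichlet w k.+1 x != 0%R ->
  (ln lambda - ln 2 + ln `|dirichlet w k x|)%:E <=
  (ln `|dirichlet w k.+1 x|)%:E + penalty w lambda k x.
Proof.
move=> x01 l0; rewrite -!normr_gt0.
set p := `|dirichlet w k x|%R; set q := `|dirichlet w k.+1 x|%R => p0 q0.
have s0 : (0 < lambda * p / q)%R by rewrite divr_gt0// mulr_gt0.
have [m [mS mln]] := dyadic_log_bound s0.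
apply: le_trans (leeD2l _ (@le_penalty w lambda k x m _)); last first.
  move=> i im; split=> //; rewrite -/p -/q mulrAC ler_pdivlMr ?ltr0n ?expn_gt0//.
  by rewrite mulrC -ler_pdivlMr//; exact: mS.
rewrite -EFinD lee_fin.
move: mln; rewrite lnM ?posrE ?invr_gt0 ?mulr_gt0// lnM ?posrE// lnV ?posrE//.
by rewrite -natr1 mulrDl mul1r; lra.
Qed.

End penalty.

(** * Norms of two by two matrices and cocycle identities *)

Section norms.
Context {R : realType}.
Implicit Types (A B : 'M[R]_2) (u : 'cV[R]_2).

(** A norm that is submultiplicative, comparable to the operator norm, and
    visibly measurable in the entries. *)
Definition entry_sum A : R := `|A 0 0| + `|A 0 1| + (`|A 1 0| + `|A 1 1|).

Lemma entry_sumM A B : entry_sum (A *m B) <= entry_sum A * entry_sum B.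
Proof.
rewrite /entry_sum !mul2mxE.
have tri (a b c d : R) : `|a * b + c * d| <= `|a| * `|b| + `|c| * `|d|.
  by rewrite -!normrM ler_normD.
apply: le_trans (lerD (lerD (tri _ _ _ _) (tri _ _ _ _))
  (lerD (tri _ _ _ _) (tri _ _ _ _))) _.
move: (normr_ge0 (A 0 0)) (normr_ge0 (A 0 1)) (normr_ge0 (A 1 0)) (normr_ge0 (A 1 1))
  (normr_ge0 (B 0 0)) (normr_ge0 (B 0 1)) (normr_ge0 (B 1 0)) (normr_ge0 (B 1 1)).
move: `|A 0 0| `|A 0 1| `|A 1 0| `|A 1 1| `|B 0 0| `|B 0 1| `|B 1 0| `|B 1 1|.
move=> a b c d e f g h a0 b0 c0 d0 e0 f0 g0 h0.
rewrite -subr_ge0 (_ : _ - _ = a * g + a * h + b * e + b * f + (c * g + c * h + d * e + d * f)); last by ring.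
by rewrite !addr_ge0// mulr_ge0.
Qed.

Lemma euclidean_norm2E u : euclidean_norm u = Num.sqrt (u 0 0 ^+ 2 + u 1 0 ^+ 2).
Proof.
rewrite /euclidean_norm big_ord_recl big_ord1; congr (Num.sqrt (_ + u _ _ ^+ 2)).
exact: val_inj.
Qed.

Lemma norm_entry_le_euclidean u i : `|u i 0| <= euclidean_norm u.
Proof.
rewrite euclidean_norm2E -sqrtr_sqr ler_wsqrtr//.
have : i = 0 \/ i = 1 by case: i => -[|[]]//= ?; [left|right]; apply: val_inj.
by case=> ->; rewrite ?lerDl ?lerDr sqr_ge0.
Qed.

Lemma euclidean_le_entry_sum A u :
  euclidean_norm u = 1 -> euclidean_norm (A *m u) <= entry_sum A.
Proof.
move=> u1; have := norm_entry_le_euclidean u 0; have := norm_entry_le_euclidean u 1.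
rewrite u1 => h1 h0.
have le_sum (x y : R) : Num.sqrt (x ^+ 2 + y ^+ 2) <= `|x| + `|y|.
  rewrite -[leRHS]ger0_norm ?addr_ge0// -sqrtr_sqr ler_wsqrtr// sqrrD !real_normK ?num_real//.
  by rewrite lerD2r lerDl mulrn_wge0// mulr_ge0.
have le_entry (a b : R) : `|a * u 0 0 + b * u 1 0| <= `|a| + `|b|.
  rewrite (le_trans (ler_normD _ _))// lerD// normrM -[leRHS]mulr1 ler_wpM2l//.
rewrite euclidean_norm2E !mul2mxE (le_trans (le_sum _ _))// lerD//.
Qed.

Lemma euclidean_norm_delta (j : 'I_2) : euclidean_norm (delta_mx j 0 : 'cV[R]_2) = 1.
Proof.
rewrite euclidean_norm2E !mxE; case: j => -[|[]]//= ?.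
all: by rewrite ?expr1n ?expr0n /= ?addr0 ?add0r sqrtr1.
Qed.

Lemma euclidean_le_operator_norm A u :
  euclidean_norm u = 1 -> euclidean_norm (A *m u) <= operator_norm A.
Proof.
move=> u1; apply: ub_le_sup; last by exists u.
by exists (entry_sum A) => _ [z /= z1 <-]; exact: euclidean_le_entry_sum.
Qed.

Lemma operator_norm_le_entry_sum A : operator_norm A <= entry_sum A.
Proof.
apply: ge_sup => [|_ [u /= u1 <-]]; last exact: euclidean_le_entry_sum.
by exists (euclidean_norm (A *m delta_mx 0 0)); exists (delta_mx 0 0); rewrite //=
  euclidean_norm_delta.
Qed.

Lemma column_le_operator_norm A j :
  Num.sqrt (A 0 j ^+ 2 + A 1 j ^+ 2) <= operator_norm A.
Proof.
have := euclidean_le_operator_norm A (euclidean_norm_delta j).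
by rewrite -colE euclidean_norm2E !mxE.
Qed.

Lemma entry_sum_le_operator_norm A : entry_sum A <= 4 * operator_norm A.
Proof.
have h i j : `|A i j| <= operator_norm A.
  have := euclidean_le_operator_norm A (euclidean_norm_delta j).
  by apply: le_trans; apply: le_trans (norm_entry_le_euclidean _ i); rewrite -colE mxE.
rewrite /entry_sum.
have := h 0 0; have := h 0 1; have := h 1 0; have := h 1 1; lra.
Qed.

Lemma det2E A : \det A = A 0 0 * A 1 1 - A 0 1 * A 1 0.
Proof.
rewrite (expand_det_row _ 0) big_ord_recl big_ord1 /cofactor !det_mx11 !mxE /=.
rewrite expr0 expr1 mul1r mulN1r mulrN; congr (A _ _ * A _ _ - A _ _ * A _ _).
all: exact: val_inj.
Qed.

(** By Hadamard's inequality the product of the lengths of the two columns is at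
    least 1, and the operator norm dominates both. *)
Lemma operator_norm_ge1 A : \det A = 1 -> 1 <= operator_norm A.
Proof.
rewrite det2E => d1.
have := column_le_operator_norm A 0; have := column_le_operator_norm A 1.
set s := operator_norm A => h1 h0.
have s0 : 0 <= s by apply: le_trans h0; rewrite sqrtr_ge0.
have sq j : Num.sqrt (A 0 j ^+ 2 + A 1 j ^+ 2) <= s -> A 0 j ^+ 2 + A 1 j ^+ 2 <= s ^+ 2.
  by move=> h; rewrite -[leLHS]sqr_sqrtr ?addr_ge0 ?sqr_ge0// lerXn2r// nnegrE sqrtr_ge0.
have := ler_pM (addr_ge0 (sqr_ge0 _) (sqr_ge0 _)) (addr_ge0 (sqr_ge0 _) (sqr_ge0 _)) (sq _ h0) (sq _ h1).
rewrite -exprD => hprod.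
rewrite -(@ler_pXn2r _ 4) ?nnegrE// expr1n; apply: le_trans hprod.
have -> : 1 = (A 0 0 * A 1 1 - A 0 1 * A 1 0) ^+ 2 :> R by rewrite d1 expr1n.
rewrite -subr_ge0.
rewrite (_ : _ - _ = (A 0 0 * A 0 1 + A 1 0 * A 1 1) ^+ 2) ?sqr_ge0//.
by ring.
Qed.

End norms.

Section cocycle.
Context {R : realType}.
Implicit Types (w : R -> R).

Lemma det_schrodinger w x : \det (schrodinger_cocycle w x) = 1.
Proof. by rewrite det2E !mxE /= mulr0 mulr1 sub0r opprK. Qed.

Lemma det_cocycle_iter w n x : \det (cocycle_iter (schrodinger_cocycle w) n x) = 1.
Proof.
elim: n => [|n IH]; first by rewrite /= det1.
by rewrite cocycle_iterS det_mulmx det_schrodinger IH mulr1.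
Qed.

Lemma cocycle_iterD d (A : R -> 'M[R]_d) m n x :
  cocycle_iter A (m + n) x = cocycle_iter A n (2 ^+ m * x) *m cocycle_iter A m x.
Proof.
elim: n => [|n IH]; first by rewrite addn0 mul1mx.
by rewrite addnS !cocycle_iterS IH mulmxA mulrA -exprD addnC.
Qed.

End cocycle.

(** * Subadditive sequences *)

Lemma subadditive_mulDn (R : realType) (a : nat -> R) (m q r : nat) :
  (forall m n, a (m + n)%N <= a m + a n) ->
  a (q * m + r)%N <= q%:R * a m + a r.
Proof.
move=> sub; elim: q => [|q IH]; first by rewrite mul0r add0r.
rewrite mulSn -addnA -natr1 mulrDl mul1r [X in X + _]addrC -addrA.
by apply: le_trans (sub _ _) _; rewrite lerD2l.
Qed.

(** The limit is the infimum of a_n / n over n >= 1: dividing n by a fixed m with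
    a_m / m close to the infimum, subadditivity bounds a_n by n a_m / m plus one
    of the finitely many values a_r with r < m. *)
Lemma fekete_cvg (R : realType) (a : nat -> R) :
  (forall n, 0 <= a n) -> (forall m n, a (m + n)%N <= a m + a n) ->
  cvgn (fun n => n%:R^-1 * a n).
Proof.
move=> a0 sub; pose S := [set m.+1%:R^-1 * a m.+1 | m in [set: nat]].
have S0 : lbound S 0 by move=> _ [m _ <-]; rewrite mulr_ge0.
have Sinf : has_inf S by split; [exists (1%:R^-1 * a 1%N); exists 0%N | exists 0].
apply/cvg_ex; exists (inf S); apply/cvgrPdist_le => e e0.
have e20 : 0 < e / 2 by rewrite divr_gt0.
have [_ [m _ <-] mlt] := inf_adherent e20 Sinf.
pose B := \sum_(r < m.+1) a r.
have aB r : (r < m.+1)%N -> a r <= B.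
  move=> rm; rewrite /B (bigD1 (Ordinal rm))//= lerDl sumr_ge0//.
near=> n.
have n0 : 0 < n%:R :> R by rewrite ltr0n; near: n; exists 1%N.
have nB : B / n%:R <= e / 2.
  rewrite ler_pdivrMr// mulrC -ler_pdivrMr//; near: n.
  exact: nbhs_infty_ger.
have Sn : inf S <= n%:R^-1 * a n.
  apply: ge_inf; first by case: Sinf.
  by exists n.-1 => //; rewrite prednK// -(ltr0n R).
rewrite ler0_norm ?subr_le0// opprB lerBlDr.
have := subadditive_mulDn m.+1 (n %/ m.+1) (n %% m.+1) sub.
rewrite -divn_eq => h.
have h2 : a n <= (n%/ m.+1)%:R * a m.+1 + B.
  by apply: le_trans h _; rewrite lerD2l aB// ltn_mod.
have h3 : (n%/ m.+1)%:R * a m.+1 <= n%:R * (m.+1%:R^-1 * a m.+1).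
  rewrite mulrA ler_wpM2r//.
  by rewrite ler_pdivlMr// -natrM ler_nat leq_trunc_div.
have h4 : n%:R^-1 * a n <= m.+1%:R^-1 * a m.+1 + B / n%:R.
  rewrite -(ler_pM2l n0) mulVKf ?gt_eqF//.
  rewrite mulrDr [_ * (B / _)]mulrCA divff ?gt_eqF// mulr1.
  by apply: le_trans h2 _; rewrite lerD2r.
apply: le_trans h4 _; apply: le_trans (lerD (ltW mlt) nB) _.
by rewrite -addrA -splitr addrC.
Unshelve. all: by end_near.
Qed.

(** * Invariance of Lebesgue measure under doubling *)

Section invariance.
Context {R : realType}.
Local Open Scope ereal_scope.
Local Notation mu := (@lebesgue_measure R).

Let dbl : measurableTypeR R -> measurableTypeR R := fun x => (2 * x)%R.
Let shift1 : measurableTypeR R -> measurableTypeR R := fun x => (x + 1)%R.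

Let mdbl : measurable_fun [set: _] dbl.
Proof. exact: measurable_funM. Qed.

Let mshift1 : measurable_fun [set: _] shift1.
Proof. exact: measurable_funD. Qed.

(** Both measures give the same mass to half-open intervals. *)
Lemma lebesgue_measure_double (A : set (measurableTypeR R)) : measurable A ->
  pushforward (mscale (2%:nng)%R mu) dbl A = mu A.
Proof.
move=> mA; apply/esym/lebesgue_measure_unique => //= _ [[a b]] _ <-.
rewrite /pushforward (_ : dbl @^-1` `]a, b] = `](a / 2)%R, (b / 2)%R]%classic); last first.
  by apply/seteqP; split => x /=; rewrite !in_itv /= ltr_pdivrMr// ler_pdivlMr// [(x * _)%R]mulrC.
rewrite /mscale/= !lebesgue_measure_itv/= !lte_fin ltr_pM2r ?invr_gt0//.
case: ifP => ab; rewrite ?mule0// -!EFinB -EFinM; congr EFin.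
by rewrite -mulrBl mulrCA divff ?mulr1.
Qed.

Lemma lebesgue_measure_shift1 (A : set (measurableTypeR R)) : measurable A ->
  pushforward mu shift1 A = mu A.
Proof.
move=> mA; apply/esym/lebesgue_measure_unique => //= _ [[a b]] _ <-.
rewrite /pushforward (_ : shift1 @^-1` `]a, b] = `](a - 1)%R, (b - 1)%R]%classic); last first.
  by apply/seteqP; split => x /=; rewrite !in_itv /= ltrBlDr lerBrDr.
rewrite !lebesgue_measure_itv/= !lte_fin ltrD2r.
by case: ifP => ab//; rewrite -!EFinB; congr EFin; ring.
Qed.

(** As x runs through [0, 1), 2 x runs at double speed through the two periods
    [0, 1) and [1, 2). *)
Lemma integral_doubling (g : R -> \bar R) :
  circle_fun g -> measurable_fun setT g -> (forall x, 0 <= g x) ->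
  \int[mu]_(x in `[0%R, 1%R[) g (2 * x)%R = \int[mu]_(x in `[0%R, 1%R[) g x.
Proof.
move=> gper mg g0.
have mgD (D : set R) : measurable_fun D g by exact: measurable_funTS.
have shiftE : \int[mu]_(x in `[0%R, 1%R[) g (x + 1)%R = \int[mu]_(x in `[1%R, 2%R[) g x.
  have -> : `[0%R, 1%R[%classic = shift1 @^-1` `[1%R, 2%R[.
    by apply/seteqP; split => x /=; rewrite /shift1 !in_itv /= => /andP[? ?]; apply/andP; split; lra.
  rewrite -(ge0_integral_pushforward mshift1)//=; last exact: mgD.
  by apply: eq_measure_integral => //= A mA _; rewrite lebesgue_measure_shift1.
have dblE : \int[mscale (2%:nng)%R mu]_(x in `[0%R, 1%R[) g (2 * x)%R =
    \int[mu]_(x in `[0%R, 2%R[) g x.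
  have -> : `[0%R, 1%R[%classic = dbl @^-1` `[0%R, 2%R[.
    by apply/seteqP; split => x /=; rewrite /dbl !in_itv /= => /andP[? ?]; apply/andP; split; lra.
  rewrite -(ge0_integral_pushforward mdbl)//=; last exact: mgD.
  by apply: eq_measure_integral => //= A mA _; rewrite lebesgue_measure_double.
have split_itv : \int[mu]_(x in `[0%R, 2%R[) g x =
    \int[mu]_(x in `[0%R, 1%R[) g x + \int[mu]_(x in `[1%R, 2%R[) g x.
  rewrite -ge0_integral_setU//.
  - congr integral; apply/seteqP; split => x /=; rewrite !in_itv /=.
      by move=> /andP[x0 x2]; case: (ltP x 1%R) => x1; [left|right]; rewrite ?x0 ?x1.
    by move=> [] /andP[? ?]; apply/andP; split; lra.
  - exact: mgD.
  - apply/disj_setPS => x [] /=; rewrite !in_itv /= => /andP[_ x1] /andP[x1' _].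
    by move: x1; rewrite ltNge x1'.
move: dblE; rewrite split_itv -shiftE ge0_integral_mscale//=; last first.
  by apply: measurableT_comp => //; exact: measurable_funTS mdbl.
under [X in _ = _ + X]eq_integral => x _ do rewrite gper.
rewrite -mule2n -mule_natl => /(congr1 (fun z => (2^-1)%:E * z)).
by rewrite !muleA -!EFinM mulVf// !mul1e.
Qed.
End invariance.

(** * Lower bound for the Lyapunov exponent *)

(** The integral of a nonnegative function is the supremum of the integrals of
    the simple functions below it, hence monotone on all functions. *)
Lemma ge0_le_integral_nonmeasurable d (T : measurableType d) (R : realType)
    (mu : {measure set T -> \bar R}) (D : set T) (f g : T -> \bar R) :
  (forall x, D x -> 0 <= f x)%E -> (forall x, D x -> f x <= g x)%E ->
  (\int[mu]_(x in D) f x <= \int[mu]_(x in D) g x)%E.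
Proof.
move=> f0 fg; have g0 x : D x -> (0 <= g x)%E by move=> Dx; apply: le_trans (fg _ Dx); exact: f0.
rewrite !ge0_integralE//; apply: le_ereal_sup => _ [h /= hf <-]; exists h => //= x.
by apply: le_trans (hf x) _; exact: lee_restrict.
Qed.

Section exponent.
Context {R : realType}.
Local Notation mu := (@lebesgue_measure R).
Implicit Types (w : R -> R) (c t lambda : R).

Definition log_growth w n x : R :=
  ln (entry_sum (cocycle_iter (schrodinger_cocycle w) n x)).

Lemma entry_sum_cocycle_ge1 w n x :
  1 <= entry_sum (cocycle_iter (schrodinger_cocycle w) n x).
Proof.
apply: le_trans (operator_norm_le_entry_sum _).
by apply: operator_norm_ge1; exact: det_cocycle_iter.
Qed.

Lemma log_growth_ge0 w n x : 0 <= log_growth w n x.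
Proof. exact/ln_ge0/entry_sum_cocycle_ge1. Qed.

Lemma measurable_log_growth w n :
  measurable_fun setT w -> measurable_fun setT (log_growth w n).
Proof.
move=> mw.
have mA i j : measurable_fun setT (fun x => cocycle_iter (schrodinger_cocycle w) n x i j).
  elim: n i j => [|n IH] i j; first exact: measurable_cst.
  under eq_fun do rewrite cocycle_iterS mul2mxE.
  have mS k l : measurable_fun setT (fun x : R => schrodinger_cocycle w (2 ^+ n * x) k l).
    under eq_fun do rewrite mxE.
    case: k => -[|[|//]] kp; case: l => -[|[|//]] lp /=; try exact: measurable_cst.
    by apply: measurableT_comp => //; exact: measurable_funM.
  by apply: measurable_funD; apply: measurable_funM.
apply: measurableT_comp; first exact: measurable_ln.
by apply: measurable_funD; apply: measurable_funD; exact: measurableT_comp.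
Qed.

Lemma circle_fun_log_growth w n : circle_fun w -> circle_fun (log_growth w n).
Proof.
move=> wper x; rewrite /log_growth; congr (ln (entry_sum _)).
elim: n => [//|n IH]; rewrite !cocycle_iterS IH; congr (_ *m _).
apply/matrixP => i j; rewrite !mxE mulrDr mulr1 -natrX.
by rewrite circle_fun_natD.
Qed.

Lemma log_growthD w m n x :
  log_growth w (m + n) x <= log_growth w m x + log_growth w n (2 ^+ m * x).
Proof.
have pos k y : 0 < entry_sum (cocycle_iter (schrodinger_cocycle w) k y).
  by rewrite (lt_le_trans ltr01)// entry_sum_cocycle_ge1.
rewrite /log_growth -lnM ?posrE// ler_ln ?posrE ?mulr_gt0//.
by rewrite cocycle_iterD [leRHS]mulrC entry_sumM.
Qed.

Lemma log_growth_bounded w n (M : R) : (forall x, `|w x| <= M) ->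
  exists B, forall x, log_growth w n x <= B.
Proof.
move=> wM; have M0 : 0 <= M by apply: le_trans (wM 0).
exists (ln (2 * (M + 2) ^+ n)) => x.
rewrite ler_ln ?posrE; last 2 first.
- by rewrite (lt_le_trans ltr01)// entry_sum_cocycle_ge1.
- by rewrite mulr_gt0// exprn_gt0//; lra.
elim: n => [|n IH].
  rewrite /entry_sum /= !mxE /= !normr0 !normr1 mulr1; lra.
rewrite cocycle_iterS (le_trans (entry_sumM _ _))// exprS mulrCA.
apply: ler_pM => //; rewrite ?/entry_sum ?addr_ge0//.
rewrite !mxE /= normrN1 normr1 normr0 addr0 -addrA lerD2r; exact: wM.
Qed.

Definition mean_growth w n : R :=
  \int[mu]_(x in `[0, 1[) log_growth w n x.

Lemma lebesgue_measure_itv01 : mu `[(0 : R), 1[ = 1%E.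
Proof. by rewrite lebesgue_measure_itv /= lte_fin ltr01 -EFinB subr0. Qed.

Lemma mean_growthE w n (M : R) : (forall x, `|w x| <= M) ->
  (mean_growth w n)%:E = (\int[mu]_(x in `[0%R, 1%R[) (log_growth w n x)%:E)%E.
Proof.
move=> wM; have [B gB] := log_growth_bounded n wM.
rewrite /mean_growth /Rintegral fineK// ge0_fin_numE; last first.
  by apply: integral_ge0 => x _; rewrite lee_fin log_growth_ge0.
apply: (@le_lt_trans _ _ (\int[mu]_(x in `[0%R, 1%R[) (cst B%:E x))%E).
  apply: ge0_le_integral_nonmeasurable => x _ /=; rewrite lee_fin; [|exact: gB].
  exact: log_growth_ge0.
by rewrite integral_cst// [X in (_ * X)%E]lebesgue_measure_itv01 mule1 ltry.
Qed.

Lemma mean_growth_ge0 w n : 0 <= mean_growth w n.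
Proof. by apply: Rintegral_ge0 => x _; exact: log_growth_ge0. Qed.

(** The cocycle splits as A_(m+n)(x) = A_n(2^m x) A_m(x), and doubling preserves
    the mean of the first factor. *)
Lemma mean_growthD w m n (M : R) : circle_fun w -> measurable_fun setT w ->
  (forall x, `|w x| <= M) ->
  mean_growth w (m + n) <= mean_growth w m + mean_growth w n.
Proof.
move=> wper mw wM; rewrite -lee_fin EFinD !(mean_growthE _ wM).
have inv k : (\int[mu]_(x in `[0%R, 1%R[) (log_growth w n (2 ^+ k * x))%:E =
    \int[mu]_(x in `[0%R, 1%R[) (log_growth w n x)%:E)%E.
  elim: k => [|k IH]; first by under eq_integral do rewrite mul1r.
  rewrite -IH -(@integral_doubling R (fun x => (log_growth w n (2 ^+ k * x))%:E)).
  - by apply: eq_integral => x _; rewrite mulrA -exprSr.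
  - by move=> x; rewrite mulrDr mulr1 -natrX circle_fun_natD//; exact: circle_fun_log_growth.
  - apply/measurable_EFinP; apply: measurableT_comp; first exact: measurable_log_growth.
    exact: measurable_funM.
  - by move=> x; rewrite lee_fin log_growth_ge0.
have mg k : measurable_fun (`[(0 : R), 1[%classic : set (measurableTypeR R))
    (fun x => (log_growth w n (2 ^+ k * x))%:E).
  apply/measurable_EFinP/measurable_funTS; apply: measurableT_comp; first exact: measurable_log_growth.
  exact: measurable_funM.
have mg' : measurable_fun (`[(0 : R), 1[%classic : set (measurableTypeR R)) (fun x => (log_growth w m x)%:E).
  by apply/measurable_EFinP/measurable_funTS; exact: measurable_log_growth.
rewrite -(inv m) -(ge0_integralD _ _ _ mg' _ (mg m))//;
  try by move=> x _; rewrite lee_fin log_growth_ge0.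
apply: ge0_le_integral_nonmeasurable => x _; rewrite -?EFinD lee_fin ?log_growth_ge0//.
exact: log_growthD.
Qed.

(** If no u_k with k <= n vanishes, the inequalities of [penalty_step] telescope;
    otherwise the right-hand side is infinite. *)
Lemma log_growth_lower_bound w lambda n x : 0 <= x < 1 -> 0 < lambda ->
  ((n%:R * (ln lambda - ln 2))%:E <=
    (log_growth w n x)%:E + \sum_(0 <= k < n) penalty w lambda k x)%E.
Proof.
move=> x01 l0.
have [[k kn uk]|nz] := pselect (exists2 k, (k < n)%N & dirichlet w k.+1 x = 0).
  rewrite (_ : (\sum_(0 <= k < n) _)%E = +oo%E) ?addey ?leey//.
  rewrite big_mkord (bigD1 (Ordinal kn))//= penalty_vanishing// addye//.
  rewrite gt_eqF// (lt_le_trans (ltNyr 0))// sume_ge0// => i _; exact: penalty_ge0.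
have {}nz k : (k <= n)%N -> dirichlet w k x != 0.
  case: k => [_|k kn]; first by rewrite dirichlet0 oner_neq0.
  by apply/eqP => e; apply: nz; exists k.
apply: (@le_trans _ _ ((ln `|dirichlet w n x|)%:E + \sum_(0 <= k < n) penalty w lambda k x)%E).
  elim: n nz => [|n IH] nz.
    by rewrite big_geq// dirichlet0 normr1 ln1 mul0r adde0.
  have {}IH := IH (fun k kn => nz k (leqW kn)).
  have step := penalty_step x01 l0 (nz n (leqnSn n)) (nz n.+1 (leqnn _)).
  rewrite big_nat_recr//= -(@leeD2lE _ (ln `|dirichlet w n x|)%:E)//.
  have := leeD IH step; rewrite -!EFinD.
  have -> : n%:R * (ln lambda - ln 2) + (ln lambda - ln 2 + ln `|dirichlet w n x|) =
      ln `|dirichlet w n x| + n.+1%:R * (ln lambda - ln 2).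
    by rewrite -(natr1 n) mulrDl mul1r addrA addrC.
  by move=> /le_trans; apply; rewrite addeACA -addeA.
rewrite leeD2r// lee_fin /log_growth.
have Un0 : 0 < `|dirichlet w n x| by rewrite normr_gt0 nz.
rewrite ler_ln ?posrE//; last by rewrite (lt_le_trans ltr01)// entry_sum_cocycle_ge1.
by rewrite /entry_sum /dirichlet -addrA lerDl !addr_ge0.
Qed.

(** Integration of [log_growth_lower_bound].  When lambda <= 2 the bound is
    nonpositive and the means are not negative, which leaves a nonnegative
    constant to integrate. *)
Lemma mean_growth_lower_bound w c lambda n (M : R) :
  0 < c -> 0 < lambda -> circle_fun w -> measurable_fun setT w ->
  (forall x, `|w x| <= M) -> expanding c w \/ expanding c (fun x => - w x) ->
  n%:R * (ln lambda - ln 2 - 4 * ln 2 * lambda / c) <= mean_growth w n.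
Proof.
move=> c0 l0 wper mw wM wexp.
have ln20 : 0 <= ln 2 :> R by rewrite ln_ge0// ler1n.
have K0 : 0 <= 4 * ln 2 * lambda / c by rewrite !mulr_ge0 ?invr_ge0// ltW.
have [neg|pos] := leP (ln lambda - ln 2) 0.
  apply: le_trans (mean_growth_ge0 w n); rewrite mulr_ge0_le0//; lra.
rewrite mulrBr lerBlDr -lee_fin EFinD (mean_growthE n wM).
have mg : measurable_fun (`[(0 : R), 1[%classic : set (measurableTypeR R)) (fun x => (log_growth w n x)%:E).
  by apply/measurable_EFinP/measurable_funTS; exact: measurable_log_growth.
have mp k : measurable_fun (`[(0 : R), 1[%classic : set (measurableTypeR R)) (penalty w lambda k).
  exact: measurable_penalty.
apply: (@le_trans _ _ (\int[mu]_(x in `[0%R, 1%R[)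
    ((log_growth w n x)%:E + \sum_(0 <= k < n) penalty w lambda k x))%E).
  rewrite -[leLHS]mule1 -[X in (_ * X)%E]lebesgue_measure_itv01 -integral_cst//.
  apply: ge0_le_integral_nonmeasurable => x /=; rewrite in_itv /=.
    by move=> _; rewrite lee_fin mulr_ge0// ltW.
  by move=> x01; exact: log_growth_lower_bound.
rewrite (ge0_integralD _ _ _ mg _ (emeasurable_sum _ mp))//;
  try by move=> x _; rewrite lee_fin log_growth_ge0.
  2: by move=> x _; apply: sume_ge0 => k _; exact: penalty_ge0.
rewrite leeD2l// ge0_integral_sum//; last by move=> k x _; exact: penalty_ge0.
apply: (@le_trans _ _ (\sum_(0 <= k < n) (4 * ln 2 * lambda / c)%:E)%E).
  by apply: lee_sum => k _; exact: integral_penalty.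
by rewrite sumEFin lee_fin sumr_const_nat subn0 -[leLHS]mulr_natl.
Qed.

(** The logarithm of the operator norm lies between log_growth - ln 4 and
    log_growth.  It is nonnegative, as is the positive part of the lower bound,
    so the monotonicity of the integral of nonnegative functions is enough. *)
Lemma operator_growth_bounds w n (M : R) : measurable_fun setT w -> (forall x, `|w x| <= M) ->
  mean_growth w n - ln 4 <=
    \int[mu]_(x in `[0, 1[) ln (operator_norm (cocycle_iter (schrodinger_cocycle w) n x))
  <= mean_growth w n.
Proof.
move=> mw wM.
pose h x := ln (operator_norm (cocycle_iter (schrodinger_cocycle w) n x)).
have n1 x : 1 <= operator_norm (cocycle_iter (schrodinger_cocycle w) n x).
  by apply: operator_norm_ge1; exact: det_cocycle_iter.
have np x : 0 < operator_norm (cocycle_iter (schrodinger_cocycle w) n x).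
  exact: lt_le_trans (n1 x).
have ep x : 0 < entry_sum (cocycle_iter (schrodinger_cocycle w) n x).
  by rewrite (lt_le_trans ltr01)// entry_sum_cocycle_ge1.
have h0 x : 0 <= h x by exact: ln_ge0.
have hg x : h x <= log_growth w n x.
  by rewrite ler_ln ?posrE// operator_norm_le_entry_sum.
have gh x : log_growth w n x <= h x + ln 4.
  rewrite addrC -lnM ?posrE// ler_ln ?posrE ?mulr_gt0//.
  exact: entry_sum_le_operator_norm.
have gE := mean_growthE n wM.
have hle : (\int[mu]_(x in `[0%R, 1%R[) (h x)%:E <= (mean_growth w n)%:E)%E.
  by rewrite gE; apply: ge0_le_integral_nonmeasurable => x _; rewrite lee_fin.
have hge0 : (0 <= \int[mu]_(x in `[0%R, 1%R[) (h x)%:E)%E.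
  by apply: integral_ge0 => x _; rewrite lee_fin.
have hE : (\int[mu]_(x in `[0%R, 1%R[) h x)%:E = (\int[mu]_(x in `[0%R, 1%R[) (h x)%:E)%E.
  by rewrite /Rintegral fineK// ge0_fin_numE// (le_lt_trans hle)// ltry.
rewrite -/h -!lee_fin hE hle andbT EFinB leeBlDr//.
pose m x := Num.max 0 (log_growth w n x - ln 4).
have ln40 : 0 <= ln 4 :> R by rewrite ln_ge0// ler1n.
have mm : measurable_fun (`[(0 : R), 1[%classic : set (measurableTypeR R)) (fun x => (m x)%:E).
  apply/measurable_EFinP/measurable_funTS; apply: measurable_maxr => //.
  by apply: measurable_funB => //; exact: measurable_log_growth.
have m0 x : 0 <= m x by rewrite le_max lexx.
apply: (@le_trans _ _ (\int[mu]_(x in `[0%R, 1%R[) (m x)%:E + (ln 4)%:E)%E); last first.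
  rewrite leeD2r//; apply: ge0_le_integral_nonmeasurable => x _; rewrite lee_fin//.
  by rewrite ge_max h0 lerBlDr gh.
rewrite -[X in (_ <= _ + X)%E]mule1 -[X in (_ + _ * X)%E]lebesgue_measure_itv01 -integral_cst//.
rewrite -(ge0_integralD _ _ _ mm)//; try by move=> x _; rewrite lee_fin.
rewrite gE; apply: ge0_le_integral_nonmeasurable => x _; rewrite -?EFinD lee_fin ?log_growth_ge0//.
by rewrite -lerBlDr le_max lexx orbT.
Qed.

(** The slope of E - lambda v is lambda times that of v, so that lambda cancels
    in the constant of [mean_growth_lower_bound]. *)
Lemma lyapunov_lower_bound (v : R -> R) (c M E lambda : R) :
  0 < c -> 0 < lambda -> circle_fun v -> measurable_fun setT v ->
  (forall x, `|v x| <= M) -> expanding c v \/ expanding c (fun x => - v x) ->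
  ln lambda - ln 2 - 4 * ln 2 / c <= lyapunov_exponent v E lambda.
Proof.
move=> c0 l0 vper mv vM vexp.
pose w y := E - lambda * v y.
have wper : circle_fun w by move=> x; rewrite /w vper.
have mw : measurable_fun setT w.
  by apply: measurable_funB => //; exact: measurable_funM.
have wM x : `|w x| <= `|E| + lambda * M.
  rewrite (le_trans (ler_normB _ _))// lerD2l normrM gtr0_norm// ler_pM2l//.
have wexp : expanding (lambda * c) w \/ expanding (lambda * c) (fun x => - w x).
  case: vexp => vexp; [right|left] => x y x0 xy y1; have := vexp x y x0 xy y1.
    rewrite -(ler_pM2l l0) /w => h; apply: le_trans (_ : _ <= lambda * (v y - v x)) _; [lra|lra].
  rewrite -(ler_pM2l l0) /w => h; apply: le_trans (_ : _ <= lambda * (- v y - - v x)) _; [lra|lra].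
have lc0 : 0 < lambda * c by rewrite mulr_gt0.
have low n := mean_growth_lower_bound n lc0 l0 wper mw wM wexp.
have sub m n := mean_growthD m n wper mw wM.
have cva := fekete_cvg (mean_growth_ge0 w) sub.
have bounds n := operator_growth_bounds n mw wM.
rewrite /lyapunov_exponent -/w.
set b := fun n : nat => _.
have cvb : b n @[n --> \oo] --> limn (fun n => n%:R^-1 * mean_growth w n).
  apply: (@squeeze_cvgr _ _ _ _
    (fun n => n%:R^-1 * mean_growth w n - n%:R^-1 * ln 4)
    (fun n => n%:R^-1 * mean_growth w n)) => //.
    near=> n; rewrite -mulrBr !ler_wpM2l//=; by case/andP: (bounds n).
  rewrite -[X in _ --> X]subr0; apply: cvgB => //.
  rewrite -(mul0r (ln 4)); apply: cvgMl.
  by apply/gtr0_cvgV0; [near=> n; rewrite ltr0n; near: n; exists 1%N|exact: cvgr_idn].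
rewrite (cvg_lim _ cvb)//; apply: limr_ge => //.
near=> n; have n0 : 0 < n%:R :> R by rewrite ltr0n; near: n; exists 1%N.
rewrite ler_pdivlMl// (_ : 4 * ln 2 / c = 4 * ln 2 * lambda / (lambda * c)) ?low//.
by field; rewrite (gt_eqF c0) (gt_eqF l0).
Unshelve. all: by end_near. Qed.
End exponent.

Lemma circle_fun_bounded (R : realType) (f : R -> R) (M : R) :
  circle_fun f -> (forall x, 0 <= x < 1 -> `|f x| <= M) -> forall x, `|f x| <= M.
Proof.
move=> fper fM x; rewrite -[x](subrK (Num.floor x)%:~R) circle_fun_intD//.
have /andP[h1 h2] := floor_itv x; apply: fM.
by rewrite subr_ge0 h1 ltrBlDr addrC -[1]/(1%:~R) -intrD.
Qed.

Theorem theorem1 (R : realType) (v : R -> R)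
  (v_per : circle_fun v)
  (v_derivable : forall x : R, x \in `]0, 1[ -> derivable v x 1)
  (v_C1 : {in `]0, 1[, continuous (derive1 v)})
  (v_bounded : has_ubound [set `|v x| + `|derive1 v x| | x in `]0, 1[])
  (v'_lower : 0 < inf [set `|derive1 v x| | x in `]0, 1[])
  (v_0 : v x @[x --> (0 : R)^'+] --> v 0) :
  exists C0 : R, 0 < C0 /\
    forall lambda E : R, 0 < lambda ->
      lyapunov_exponent v E lambda > ln lambda - C0.
Proof.
pose c := inf [set `|derive1 v x| | x in `]0, 1[].
have c_le x : x \in `]0, 1[ -> c <= `|derive1 v x|.
  move=> x01; apply: ge_inf; last by exists x.
  by exists 0 => _ [y _ <-].
have vexp : expanding c v \/ expanding c (fun x => - v x).
  have [pos|neg] := derivative_constant_sign v'_lower v_C1 c_le; [left|right].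
    exact: expanding_of_derivative.
  apply: expanding_of_derivative => [x x01|x x01|].
  - by apply: derivableN; exact: v_derivable.
  - have Dv : 'D_1 (fun y => - v y) x = - 'D_1 v x by exact/deriveN/v_derivable.
    by rewrite derive1E Dv -derive1E lerNr; exact: neg.
  - exact: cvgN.
have [M vM] := v_bounded.
have vB x : `|v x| <= Num.max M `|v 0|.
  apply: circle_fun_bounded x => // x /andP[]; rewrite le_eqVlt => /predU1P[<- _|x0 x1].
    by rewrite le_max lexx orbT.
  rewrite le_max; apply/orP; left; apply: le_trans (vM (`|v x| + `|derive1 v x|) _).
    by rewrite lerDl.
  by exists x => //=; rewrite in_itv /= x0.
have vc : {in `]0, 1[, continuous v}.
  by move=> x /v_derivable dx; apply/differentiable_continuous/derivable1_diffP.
have mv : measurable_fun setT v.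
  by apply: measurable_circle_fun => //; exact: measurable_of_continuous_itvoo.
have ln20 : 0 <= ln 2 :> R by rewrite ln_ge0// ler1n.
have K0 : 0 <= 4 * ln 2 / c by rewrite !mulr_ge0 ?invr_ge0// ltW.
exists (ln 2 + 4 * ln 2 / c + 1); split=> [|lambda E l0]; first by lra.
apply: lt_le_trans (lyapunov_lower_bound E v'_lower l0 v_per mv vB vexp).
rewrite -/c; lra.
Qed.
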